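(* Let $p,n,m\ge 1$ be integers, let $A_0,\dots,A_{p-1}\in\mathbb{R}^{n\times n}$ and $B_0,\dots,B_{p-1}\in\mathbb{R}^{n\times m}$, and consider the discrete-time linear periodic system of period $p$ $$x_{pk+i}=A_{i-1}\,x_{pk+i-1}+B_{i-1}\,u_{pk+i-1},\qquad i=1,\dots,p,\quad k=0,1,2,\dots$$ with states $x_k\in\mathbb{R}^n$ and inputs $u_k\in\mathbb{R}^m$ ($k\ge 0$). Then this system is equivalent to the linear time-invariant system $$\bar x_{K+1}=\bar A\,\bar x_K+\bar B\,\bar u_K,\qquad K=0,1,2,\dots,$$ with $\bar x_K,\bar u_K$, $\bar A\in\mathbb{R}^{pn\times pn}$, $\bar B\in\mathbb{R}^{pn\times pm}$ as defined in the context. That is, sequences $(x_k)_{k\ge 0}$ in $\mathbb{R}^n$ and $(u_k)_{k\ge 0}$ in $\mathbb{R}^m$ satisfy the periodic system for all $k\ge 0$ and $1\le i\le p$ if and only if the associated lifted sequences $(\bar x_K)_{K\ge 0}$ and $(\bar u_K)_{K\ge 0}$ satisfy the time-invariant system for all $K\ge 0$. Moreover, the structure of $\bar B$ guarantees causality: the $(i,j)$ block of $\bar B$ is zero whenever $j>i$, so that in the time-invariant system the $i$-th block $x_{pK+i}$ of $\bar x_{K+1}$ depends only on $\bar x_K$ and on $u_{pK},\dots,u_{pK+i-1}$, and not on $u_{pK+i},\dots,u_{pK+p-1}$.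
   Context: For $0\le j\le i\le p$ put $\Phi_{i,j}=A_{i-1}A_{i-2}\cdots A_j$, with $\Phi_{i,i}=I_n$ (empty product). Lifted vectors: for $K\ge 1$, $\bar x_K=(x_{p(K-1)+1}^{T},x_{p(K-1)+2}^{T},\dots,x_{p(K-1)+p}^{T})^{T}\in\mathbb{R}^{pn}$; $\bar x_0=(0,\dots,0,x_0^{T})^{T}\in\mathbb{R}^{pn}$; and for $K\ge 0$, $\bar u_K=(u_{pK}^{T},u_{pK+1}^{T},\dots,u_{pK+p-1}^{T})^{T}\in\mathbb{R}^{pm}$. The matrix $\bar A\in\mathbb{R}^{pn\times pn}$ is partitioned into $p\times p$ blocks of size $n\times n$: its first $p-1$ block columns are zero and the $i$-th block of its last block column is $\Phi_{i,0}=A_{i-1}\cdots A_1A_0$, $i=1,\dots,p$. The matrix $\bar B\in\mathbb{R}^{pn\times pm}$ is partitioned into $p\times p$ blocks of size $n\times m$: its $(i,j)$ block ($1\le i,j\le p$) is $\Phi_{i,j}B_{j-1}=A_{i-1}\cdots A_jB_{j-1}$ if $i\ge j$ (so $B_{i-1}$ if $i=j$) and $0$ if $i<j$. *)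

(* Defs.v *)
From HB Require Import structures.
From mathcomp Require Import all_boot all_order all_algebra.
From mathcomp Require Import reals.
Set Implicit Arguments.
Unset Strict Implicit.
Unset Printing Implicit Defensive.
Import Order.TTheory GRing.Theory Num.Theory.
Local Open Scope ring_scope.

(* Indices. An ordinal i : 'I_p has a value in 0, .., p - 1, so it stands for  *)
(* the 1-based index i + 1 of a block or of an equation within a period; it is *)
(* also the subscript of A_i and B_i.                                          *)
(* Dimensions. Block matrices are those of the library (\mxblock, \mxcol), so  *)
(* R^(pn) appears as 'cV[R]_(\sum_(i < p) n), where \sum_(i < p) n = p * n.    *)

(* The factors are listed by decreasing index: A_(i-1) *m .. *m A_j.           *)
Definition Phi (R : realType) (p n : nat) (A : 'I_p -> 'M[R]_n) (i j : nat) :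
    'M[R]_n :=
  \big[mulmx/1%:M]_(k <- rev (enum 'I_p) | (j <= k < i)%N) A k.

Definition periodic_system (R : realType) (p n m : nat)
    (A : 'I_p -> 'M[R]_n) (B : 'I_p -> 'M[R]_(n, m))
    (x : nat -> 'cV[R]_n) (u : nat -> 'cV[R]_m) : Prop :=
  forall (k : nat) (i : 'I_p),
    x (p * k + i.+1)%N = A i *m x (p * k + i)%N + B i *m u (p * k + i)%N.

Definition lift_state (R : realType) (p n : nat) (x : nat -> 'cV[R]_n)
    (K : nat) : 'cV[R]_(\sum_(i < p) n) :=
  \mxcol_(i < p) (if K is K'.+1 then x (p * K' + i.+1)%N
                  else if i.+1 == p then x 0%N else 0).

Definition lift_input (R : realType) (p m : nat) (u : nat -> 'cV[R]_m)
    (K : nat) : 'cV[R]_(\sum_(j < p) m) :=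
  \mxcol_(j < p) u (p * K + j)%N.

Definition Abar (R : realType) (p n : nat) (A : 'I_p -> 'M[R]_n) :
    'M[R]_(\sum_(i < p) n, \sum_(j < p) n) :=
  \mxblock_(i < p, j < p) (if j.+1 == p then Phi A i.+1 0%N else 0).

Definition Bbar (R : realType) (p n m : nat)
    (A : 'I_p -> 'M[R]_n) (B : 'I_p -> 'M[R]_(n, m)) :
    'M[R]_(\sum_(i < p) n, \sum_(j < p) m) :=
  \mxblock_(i < p, j < p)
    (if (j <= i)%N then Phi A i.+1 j.+1 *m B j else 0).

(* z and v are arbitrary sequences in R^(pn) and R^(pm), not only lifted ones. *)
Definition ti_system (R : realType) (p n m : nat)
    (A : 'I_p -> 'M[R]_n) (B : 'I_p -> 'M[R]_(n, m))
    (z : nat -> 'cV[R]_(\sum_(i < p) n))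
    (v : nat -> 'cV[R]_(\sum_(j < p) m)) : Prop :=
  forall K : nat, z K.+1 = Abar A *m z K + Bbar A B *m v K.

(* Main.v *)
Require Import Defs.
From HB Require Import structures.
From mathcomp Require Import all_boot all_order all_algebra.
From mathcomp Require Import reals.
Set Implicit Arguments.
Unset Strict Implicit.
Unset Printing Implicit Defensive.
Import Order.TTheory GRing.Theory Num.Theory.
Local Open Scope ring_scope.

(* Over one period, variation of constants turns the recursion into
     x_(pK+i) = Phi_(i,0) x_(pK) + sum_(j < i) Phi_(i,j+1) B_j u_(pK+j),
   and for 1 <= i <= p this is exactly the i-th block row of the lifted
   equation, because the last block of the lifted state at K is x_(pK). *)

Lemma Phi_id (R : realType) (p n : nat) (A : 'I_p -> 'M[R]_n) (i : nat) :
  Phi A i i = 1%:M.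
Proof. by rewrite /Phi big_pred0 // => k; case: leqP. Qed.

(** The index list for [i.+1] and [i] followed by the index list for [i] are both strictly
    decreasing with the same members, hence equal; [j <= i] puts [i] in the former. *)
Lemma PhiS (R : realType) (p n : nat) (A : 'I_p -> 'M[R]_n) (i : 'I_p)
    (j : nat) :
  (j <= i)%N -> Phi A i.+1 j = A i *m Phi A i j.
Proof.
move=> le_ji; rewrite /Phi -big_filter -[in RHS]big_filter.
pose gt_ord (k l : 'I_p) := (l < k)%N.
have gt_trans : transitive gt_ord by move=> k l r lk rk; apply: ltn_trans rk lk.
have gt_irr : irreflexive gt_ord by move=> k; apply: ltnn.
have sorted_rev : sorted gt_ord (rev (enum 'I_p)).
  rewrite rev_sorted (_ : sorted _ _ = sorted ltn (map val (enum 'I_p))).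
    by rewrite val_enum_ord iota_ltn_sorted.
  by rewrite sorted_map.
rewrite (_ : [seq k : 'I_p <- _ | (j <= k < i.+1)%N]
             = i :: [seq k : 'I_p <- rev (enum 'I_p) | (j <= k < i)%N]).
  by rewrite big_cons.
apply: (irr_sorted_eq gt_trans gt_irr).
- exact: sorted_filter.
- rewrite /= path_min_sorted; first exact: sorted_filter.
  by apply/allP => k; rewrite mem_filter => /andP[/andP[_]].
move=> k; rewrite inE !mem_filter mem_rev mem_enum !andbT ltnS.
rewrite (leq_eqVlt k) -val_eqE /=.
by case: eqP => //= ->; rewrite le_ji.
Qed.

(** The offset [i] is a natural number, so that both ends 0 and [p] of a period are allowed; [v] is
    the input counted from the start of the period. *)
Definition period_flow (R : realType) (p n m : nat)
    (A : 'I_p -> 'M[R]_n) (B : 'I_p -> 'M[R]_(n, m))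
    (x0 : 'cV[R]_n) (v : nat -> 'cV[R]_m) (i : nat) : 'cV[R]_n :=
  Phi A i 0 *m x0 + \sum_(j < p | (j < i)%N) Phi A i j.+1 *m B j *m v j.

Lemma period_flow0 (R : realType) (p n m : nat) (A : 'I_p -> 'M[R]_n)
    (B : 'I_p -> 'M[R]_(n, m)) (x0 : 'cV[R]_n) (v : nat -> 'cV[R]_m) :
  period_flow A B x0 v 0 = x0.
Proof. by rewrite /period_flow Phi_id mul1mx big_pred0 ?addr0. Qed.

Lemma period_flowS (R : realType) (p n m : nat) (A : 'I_p -> 'M[R]_n)
    (B : 'I_p -> 'M[R]_(n, m)) (x0 : 'cV[R]_n) (v : nat -> 'cV[R]_m)
    (i : 'I_p) :
  period_flow A B x0 v i.+1 = A i *m period_flow A B x0 v i + B i *m v i.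
Proof.
rewrite /period_flow PhiS // mulmxDr mulmxA -addrA; congr (_ + _).
(* The new term j = i reduces to [B i *m v i]; the factor [A i] comes out of all the others. *)
rewrite (bigD1 i) //= Phi_id mul1mx addrC; congr (_ + _).
rewrite mulmx_sumr; apply: eq_big => [j|j /andP[]].
  by rewrite ltnS ltn_neqAle andbC -val_eqE.
rewrite ltnS => le_ji ne_ji.
by rewrite PhiS ?mulmxA // ltn_neqAle le_ji andbT.
Qed.

Lemma periodic_system_flow (R : realType) (p n m : nat)
    (A : 'I_p -> 'M[R]_n) (B : 'I_p -> 'M[R]_(n, m))
    (x : nat -> 'cV[R]_n) (u : nat -> 'cV[R]_m) :
  periodic_system A B x u <->
  forall K (i : 'I_p), x (p * K + i.+1)%N
    = period_flow A B (x (p * K)%N) (fun j => u (p * K + j)%N) i.+1.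
Proof.
split=> [sys K [i lt_ip] /= | flow K i].
  (* Induction on the offset within the fixed period [K]. *)
  elim: i lt_ip => [|i IHi] lt_ip; rewrite (sys K (Ordinal lt_ip)).
    by rewrite (period_flowS _ _ _ _ (Ordinal lt_ip)) period_flow0 /= addn0.
  by rewrite (period_flowS _ _ _ _ (Ordinal lt_ip)) /= IHi // ltnW.
rewrite flow period_flowS; congr (_ *m _ + _).
(* The hypothesis [flow] covers positive offsets only; at offset 0 the flow is its initial value. *)
case: i => [[|i] lt_ip] /=; first by rewrite period_flow0 addn0.
by rewrite (flow K (Ordinal (ltnW lt_ip))).
Qed.

Lemma submxcol_Bbar_lift (R : realType) (p n m : nat)
    (A : 'I_p -> 'M[R]_n) (B : 'I_p -> 'M[R]_(n, m))
    (u : nat -> 'cV[R]_m) (K : nat) (i : 'I_p) :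
  submxcol (Bbar A B *m lift_input p u K) i
  = \sum_(j < p | (j < i.+1)%N) Phi A i.+1 j.+1 *m B j *m u (p * K + j)%N.
Proof.
rewrite /Bbar /lift_input mul_mxblock_mxrow mxcolK [RHS]big_mkcond /=.
by apply: eq_bigr => j _; rewrite ltnS; case: leqP => // _; rewrite mul0mx.
Qed.

Lemma submxcol_ti_lift (R : realType) (p n m : nat)
    (A : 'I_p -> 'M[R]_n) (B : 'I_p -> 'M[R]_(n, m))
    (x : nat -> 'cV[R]_n) (u : nat -> 'cV[R]_m) (K : nat) (i : 'I_p) :
  submxcol (Abar A *m lift_state p x K + Bbar A B *m lift_input p u K) i
  = period_flow A B (x (p * K)%N) (fun j => u (p * K + j)%N) i.+1.
Proof.
rewrite submxcolD submxcol_Bbar_lift; congr (_ + _).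
rewrite /Abar /lift_state mul_mxblock_mxrow mxcolK.
have p_gt0 : (0 < p)%N by apply: leq_ltn_trans (ltn_ord i).
have lt_last : (p.-1 < p)%N by rewrite prednK.
(* All block columns of [Abar] but the last vanish, so only the last block of the lifted state
   contributes. *)
rewrite (bigD1 (Ordinal lt_last)) //= prednK // eqxx big1 ?addr0 => [|j].
  (* That block is x_(pK): by the convention on the initial lifted state if K = 0, as the end of the
     previous period otherwise. *)
  by case: K => [|K]; rewrite ?muln0 // mulnSr.
by rewrite -val_eqE /= -eqSS prednK // => /negPf ->; rewrite mul0mx.
Qed.

Theorem theorem3p1 (R : realType) (p n m : nat)
    (hp : (1 <= p)%N) (hn : (1 <= n)%N) (hm : (1 <= m)%N)
    (A : 'I_p -> 'M[R]_n) (B : 'I_p -> 'M[R]_(n, m)) :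
  [/\ (* equivalence of the two systems *)
      forall (x : nat -> 'cV[R]_n) (u : nat -> 'cV[R]_m),
        periodic_system A B x u <->
        ti_system A B (lift_state p x) (lift_input p u),
      (* the blocks of Bbar above the diagonal vanish *)
      forall i j : 'I_p, (i < j)%N -> submxblock (Bbar A B) i j = 0,
      (* the blocks of a lifted state are the x_(pK+i) *)
      forall (x : nat -> 'cV[R]_n) (K : nat) (i : 'I_p),
        submxcol (lift_state p x K.+1) i = x (p * K + i.+1)%N
    & (* causality: a block of the next state is determined by the current
         state and by the inputs up to that block *)
      forall (z z' : nat -> 'cV[R]_(\sum_(i < p) n)) (u u' : nat -> 'cV[R]_m),
        ti_system A B z (lift_input p u) ->
        ti_system A B z' (lift_input p u') ->
        forall (K : nat) (i : 'I_p),
          z K = z' K ->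
          (forall j : 'I_p, (j <= i)%N -> u (p * K + j)%N = u' (p * K + j)%N) ->
          submxcol (z K.+1) i = submxcol (z' K.+1) i].
Proof.
split.
- move=> x u; rewrite periodic_system_flow; split=> [flow K | sys K i].
    apply/mxcolP => i.
    by rewrite submxcol_ti_lift /lift_state mxcolK flow.
  by rewrite -submxcol_ti_lift -sys /lift_state mxcolK.
- by move=> i j lt_ij; rewrite /Bbar mxblockK leqNgt lt_ij.
- by move=> x K i; rewrite /lift_state mxcolK.
move=> z z' u u' sys sys' K i eq_z eq_u.
(* The state parts agree by [eq_z], and the input sum for block [i] stops at j = i. *)
rewrite sys sys' eq_z !submxcolD !submxcol_Bbar_lift; congr (_ + _).
by apply: eq_bigr => j lt_ji; rewrite eq_u.
Qed.
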